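(* Let $x_1,\ldots,x_m\in\mathbb{R}^n$ be nonzero vectors spanning $\mathbb{R}^n$, $X=[x_1,\ldots,x_m]$, $\epsilon>0$, and consider the coordinate descent (CD) algorithm applied to the problem: minimize $h(u)=-\ln\det(XUX^T)+n(e^Tu-1)$ subject to $u\ge 0$, $u\in\mathbb{R}^m$, $U=\mathrm{diag}(u)$. Let $u_{\max}$ be the (finite) supremum of all coordinates of all iterates. (i) With Khachiyan's initialization scheme (KIS), the total number of iterations of the CD algorithm to obtain an $\epsilon$-approximately optimal solution is at most $$\frac{40n(1+m\,u_{\max})}{\epsilon}+\frac{n}{c_1}\ln\Big(\frac{n\ln m}{c_2}\Big)+m,$$ where $c_1=\frac{\ln(2m-1)}{\ln m}-1$ and $c_2=c_1\ln 2$. (ii) With the Kumar–Yildirim initialization scheme (KYIS), the total number of iterations of the CD algorithm to obtain an $\epsilon$-approximately optimal solution is at most $$\frac{40n(1+m\,u_{\max})}{\epsilon}+\frac{n}{c_1}\ln\Big(\frac{5n\ln n}{c_2}\Big)+2n,$$ where $c_1=\frac{\ln(1+2n^5)}{\ln(1+n^5)}-1$ and $c_2=c_1\ln 2$.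
   Context: $e$ is the all-ones vector, $e_i$ the $i$-th standard basis vector of $\mathbb{R}^m$; $\kappa(u)_i=x_i^T(XUX^T)^{-1}x_i$. For $u\ge0$ with $XUX^T$ positive definite: $u$ is $\epsilon$-primal feasible if $\kappa(u)_i\le(1+\epsilon)n$ for all $i$; it is $\epsilon$-approximately optimal if it is $\epsilon$-primal feasible and $\kappa(u)_i\ge(1-\epsilon)n$ whenever $u_i>0$. KIS: $u_0=(1/m,\ldots,1/m)$. KYIS: produces $u_0\ge 0$ with $e^Tu_0=1$, having at most $2n$ nonzero coordinates, such that the points $x_i$ with $(u_0)_i>0$ span $\mathbb{R}^n$, and $u_0$ is $(n^5-1)$-primal feasible. CD algorithm: given the current iterate $u$ (with $XUX^T$ positive definite), let $j_+\in\arg\max_i\kappa(u)_i$, $\kappa_+=\kappa(u)_{j_+}$, $j_-\in\arg\min_{i:u_i>0}\kappa(u)_i$, $\kappa_-=\kappa(u)_{j_-}$. If $\kappa_+-n\ge n-\kappa_-$, coordinate $j_+$ is chosen and the next iterate is $u^\dagger=u+\frac{\kappa_+-n}{\kappa_+^2}e_{j_+}$. Otherwise coordinate $j_-$ is chosen and $u^\dagger$ is obtained from $u$ by replacing $u_{j_-}$ by $\max\{u_{j_-}-\frac{n-\kappa_-}{n\kappa_-},0\}$. In (i) it is understood that $m\ge2$, and in (ii) that $n\ge 2$, so that the expressions are defined. *)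

(* Defs.v *)
From HB Require Import structures.
From mathcomp Require Import all_boot all_order all_algebra.
From mathcomp Require Import all_classical all_reals all_analysis.

Set Implicit Arguments.
Unset Strict Implicit.
Unset Printing Implicit Defensive.

Import Order.TTheory GRing.Theory Num.Theory.
Local Open Scope ring_scope.

(* The points x_i are the columns [col i X] of X; a weight vector u in R^m is
   a row vector, so that U = diag(u) is [diag_mx u]. *)

Definition points_span (R : realType) (n m : nat) (X : 'M[R]_(n, m))
    (P : pred 'I_m) : Prop :=
  (<<[seq col i X | i : 'I_m in P]>> = fullv)%VS.

Definition posdef (R : realType) (n : nat) (A : 'M[R]_n) : Prop :=
  A^T = A /\ forall v : 'cV[R]_n, v != 0 -> 0 < (v^T *m A *m v) 0 0.

Definition XUXT (R : realType) (n m : nat) (X : 'M[R]_(n, m))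
    (u : 'rV[R]_m) : 'M[R]_n :=
  X *m diag_mx u *m X^T.

Definition kappa (R : realType) (n m : nat) (X : 'M[R]_(n, m))
    (u : 'rV[R]_m) (i : 'I_m) : R :=
  ((col i X)^T *m invmx (XUXT X u) *m col i X) 0 0.

Definition primal_feasible (R : realType) (n m : nat) (eps : R)
    (X : 'M[R]_(n, m)) (u : 'rV[R]_m) : Prop :=
  [/\ forall i, 0 <= u 0 i,
      posdef (XUXT X u)
    & forall i, kappa X u i <= (1 + eps) * n%:R].

Definition approx_optimal (R : realType) (n m : nat) (eps : R)
    (X : 'M[R]_(n, m)) (u : 'rV[R]_m) : Prop :=
  primal_feasible eps X u /\
  forall i, 0 < u 0 i -> (1 - eps) * n%:R <= kappa X u i.

Definition KIS (R : realType) (m : nat) : 'rV[R]_m := const_mx (m%:R^-1).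

Definition KYIS (R : realType) (n m : nat) (X : 'M[R]_(n, m))
    (u : 'rV[R]_m) : Prop :=
  [/\ forall i, 0 <= u 0 i,
      \sum_i u 0 i = 1,
      (#|[pred i | u 0%R i != 0%R]| <= 2 * n)%N,
      points_span X [pred i | 0 < u 0 i]
    & primal_feasible (n%:R ^+ 5 - 1) X u].

(* One coordinate descent step for
     minimize  h(u) = - ln det (X U X^T) + n (e^T u - 1)  subject to  u >= 0.
   It is a relation, not a function: ties in the argmax and the argmin may be
   broken arbitrarily.  Positive definiteness of X U X^T is not imposed on the
   iterates. *)
Definition cd_step (R : realType) (n m : nat) (X : 'M[R]_(n, m))
    (u u' : 'rV[R]_m) : Prop :=
  exists jp jm : 'I_m,
    let kp := kappa X u jp in
    let km := kappa X u jm in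
    [/\ forall i, kappa X u i <= kp,
        0 < u 0 jm,
        forall i, 0 < u 0 i -> km <= kappa X u i
      & u' = if n%:R - km <= kp - n%:R
             then u + ((kp - n%:R) / kp ^+ 2) *: delta_mx 0 jp
             else \row_i (if i == jm
                          then Num.max (u 0 jm - (n%:R - km) / (n%:R * km)) 0
                          else u 0 i)].

(* The step is the zero step at an exact optimum, so every run is taken to be
   infinite. *)
Definition cd_run (R : realType) (n m : nat) (X : 'M[R]_(n, m))
    (u : nat -> 'rV[R]_m) : Prop :=
  forall k, cd_step X (u k) (u k.+1).

Definition iterate_coords (R : realType) (m : nat) (u : nat -> 'rV[R]_m) :
    set R :=
  [set z | exists k i, z = u k 0%R i]%classic.

(* Meaningful only when [iterate_coords u] is bounded above: [sup] is 0
   otherwise. *)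
Definition u_max (R : realType) (m : nat) (u : nat -> 'rV[R]_m) : R :=
  sup (iterate_coords u).

(* [u k] is the iterate after k steps. *)
Definition optimal_within (R : realType) (n m : nat) (eps : R)
    (X : 'M[R]_(n, m)) (u : nat -> 'rV[R]_m) (B : R) : Prop :=
  exists k : nat, k%:R <= B /\ approx_optimal eps X (u k).

(* Main.v *)
Require Import Defs.
From HB Require Import structures.
From mathcomp Require Import all_boot all_order all_algebra.
From mathcomp Require Import all_classical all_reals all_analysis.
From mathcomp Require Import ring lra.
Set Implicit Arguments.
Unset Strict Implicit.
Unset Printing Implicit Defensive.

Import Order.TTheory GRing.Theory Num.Theory.
Local Open Scope ring_scope.

(** Write A(u) = X U X^T and h(u) = - ln det A(u) + n (e^T u - 1).  The proof
compares three things along a run: the optimality error of an iterate, the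
decrease of h that the next step achieves, and the decrease that is still
possible.

The smallest e >= 0 for which an iterate is e-approximately optimal is
max(kappa_+ / n - 1, 1 - kappa_- / n), and the algorithm moves the coordinate
that attains it.  Since det(A + l x x^T) = det A (1 + l x^T A^-1 x), the effect
of a step on h is explicit: unless the step sets a positive coordinate to 0
before it reaches its minimizer, h decreases by at least
e^2 / (8 + (9/4) e^2) ([cd_step_descent]).  The remaining steps, called drops
below, do not increase h, occur only when e < 1, and shrink the support.

Conversely, the inequality ln det B - ln det A <= tr (A^-1 B) - n for positive
definite A and B is weak duality for the problem.  It shows that
h(u) - h(v) <= n (1 + e^T u) e <= C e with C = n (1 + m u_max), whenever u is
e-approximately optimal and v is feasible ([approx_optimal_gap]).  It also
bounds h(u_0) - h(v) by n ln c when e^T u_0 = 1 and kappa(u_0) <= c n, and it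
makes the sublevel sets of h bounded, so that u_max is finite.  No optimal
solution is needed: for the first K steps, v is the K-th iterate.

Let d be the gap h(u_k) - h(u_K).  A step that is not a drop, taken at an
iterate that is not eps-approximately optimal, decreases d by at least the
reciprocal of 8 / e^2 + 9/4, where e >= max(eps, d / C).  Integrating
8 / max(eps, d / C)^2 + 9/4 in d gives a concave increasing function
[potential] of d which falls by at least 1 at every such step.  A drop removes
an index from the support, and other steps add at most one, so twice the
potential plus the support size falls by at least 1 at every step
([cd_step_count]).  Its initial value is at most
32 C / eps + (9/2) n ln c + s, where s bounds the initial support.  If
eps >= 1, no drop occurs before an eps-approximately optimal iterate is
reached, and the potential alone bounds the number of steps.

The logarithmic term of the claimed bound is at least n ((9/2) ln c - 4)
([log_term_ge]); the missing 4 n is paid by the 8 C / eps that remain from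
40 C / eps, because C >= 2 n.  When eps is so large that this fails, either
the initial iterate is already eps-approximately optimal or c is large, and
then the constants of the case eps >= 1 leave enough room.  The two
initializations are the cases c = m and c = n^5 of [cd_complexity]. *)

(** * Positive definite matrices *)

Lemma posdef_congr (R : realType) n (A P : 'M[R]_n) :
  P \in unitmx -> posdef A -> posdef (P^T *m A *m P).
Proof.
move=> uP [symA posA]; split.
  by rewrite !trmx_mul trmxK symA mulmxA.
move=> v v0.
have -> : v^T *m (P^T *m A *m P) *m v = (P *m v)^T *m A *m (P *m v).
  by rewrite trmx_mul !mulmxA.
apply: posA; apply: contra v0 => /eqP Pv0.
by rewrite -(mulKmx uP v) Pv0 mulmx0.
Qed.

Lemma posdefZ (R : realType) n (A : 'M[R]_n) (c : R) :
  0 < c -> posdef A -> posdef (c *: A).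
Proof.
move=> c0 [symA posA]; split; first by rewrite linearZ /= symA.
move=> v v0; rewrite -scalemxAr -scalemxAl mxE.
exact: mulr_gt0 (posA v v0).
Qed.

Lemma sqr_mx_ge0 (R : realType) n (v : 'cV[R]_n) : 0 <= (v^T *m v) 0 0.
Proof.
rewrite mxE; apply: sumr_ge0 => i _; rewrite mxE.
exact: sqr_ge0.
Qed.

Lemma mxtrace_gram_ge0 (R : realType) n (r : 'rV[R]_n) : 0 <= \tr (r^T *m r).
Proof.
by rewrite mxtrace_mulC trace_mx11 -{1}[r]trmxK sqr_mx_ge0.
Qed.

Definition schur_shear (R : realType) n (A : 'M[R]_(1 + n)) : 'M[R]_(1 + n) :=
  block_mx 1%:M ((A 0 0)^-1 *: ursubmx A) 0 1%:M.

Definition schur_compl (R : realType) n (A : 'M[R]_(1 + n)) : 'M[R]_n :=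
  drsubmx A - (A 0 0)^-1 *: ((ursubmx A)^T *m ursubmx A).

Lemma posdef_corner_gt0 (R : realType) n (A : 'M[R]_(1 + n)) :
  posdef A -> 0 < A 0 0.
Proof.
move=> [_ posA].
have e0 : delta_mx 0 0 != 0 :> 'cV[R]_(1 + n).
  by apply/eqP => /matrixP/(_ 0 0)/eqP; rewrite !mxE !eqxx oner_eq0.
have := posA _ e0; rewrite trmx_delta -rowE -colE.
by rewrite !mxE.
Qed.

(** Symmetric block elimination of the first row and column. It drives both
inductions on the dimension below, for the Gram factorization and for the
determinant. *)
Lemma schur_decomposition (R : realType) n (A : 'M[R]_(1 + n)) :
  posdef A ->
  A = (schur_shear A)^T *m block_mx (A 0 0)%:M 0 0 (schur_compl A)
        *m schur_shear A.
Proof.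
move=> pA; have a0 := posdef_corner_gt0 pA; case: pA => symA _.
have dl : dlsubmx A = (ursubmx A)^T by rewrite trmx_ursub symA.
have ul : ulsubmx A = (A 0 0)%:M.
  by rewrite [LHS]mx11_scalar !mxE !lshift0.
rewrite /schur_shear tr_block_mx !trmx1 trmx0 !mulmx_block !mul1mx !mul0mx.
have trZ : ((A 0 0)^-1 *: ursubmx A)^T = (A 0 0)^-1 *: (ursubmx A)^T.
  by rewrite linearZ.
rewrite !mulmx0 !mulmx1 !addr0 ?add0r trZ.
rewrite -!scalemxAl mul_mx_scalar -scalemxAr mul_scalar_mx -!scalemxAl !scalerA.
rewrite mulVf ?gt_eqF // !scale1r.
rewrite -scalemxAr addrC subrK.
by rewrite -[LHS]submxK ul dl.
Qed.

Lemma schur_compl_posdef (R : realType) n (A : 'M[R]_(1 + n)) :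
  posdef A -> posdef (schur_compl A).
Proof.
move=> pA; have dec := schur_decomposition pA.
have [symA posA] := pA; split.
  rewrite /schur_compl linearB /= linearZ /= trmx_mul trmxK.
  by rewrite trmx_drsub symA.
move=> v v0.
(* The shear sends w to (0, v), so that the form of A at w is the form of the
   Schur complement at v. *)
pose w := col_mx (- ((A 0 0)^-1 *: ursubmx A *m v)) v : 'cV_(1 + n).
have w0 : w != 0.
  by apply: contra v0; rewrite col_mx_eq0 => /andP[].
have Tw : schur_shear A *m w = col_mx 0 v.
  by rewrite mul_block_col !mul1mx mul0mx add0r addNr.
have := posA w w0; rewrite {1}dec !mulmxA -trmx_mul -mulmxA Tw -mulmxA.
rewrite mul_block_col !mul0mx mulmx0 !addr0 tr_col_mx trmx0 add0r.
by rewrite mul_row_col mul0mx add0r mulmxA.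
Qed.

Lemma gram_block (R : realType) n (a : R) (P : 'M[R]_n) : 0 < a ->
  let D : 'M[R]_(1 + n) := block_mx (Num.sqrt a)%:M 0 0 P in
  block_mx a%:M 0 0 (P^T *m P) = D^T *m D.
Proof.
move=> a0 D; rewrite /D tr_block_mx !trmx0 tr_scalar_mx mulmx_block.
rewrite !mul0mx !mulmx0 !addr0 !add0r -scalar_mxM -expr2 sqr_sqrtr //.
exact: ltW.
Qed.

(** A non-orthogonal substitute for the square root of A: it turns a statement
about the non-symmetric product A^-1 B into one about a positive definite
matrix congruent to B. *)
Lemma posdef_factor (R : realType) n (A : 'M[R]_n) :
  posdef A -> exists P : 'M[R]_n, A = P^T *m P.
Proof.
elim: n A => [|n IH] A pA; first by exists 0; rewrite !flatmx0.
have a0 := posdef_corner_gt0 pA.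
have [P eP] := IH _ (schur_compl_posdef pA).
exists (block_mx (Num.sqrt (A 0 0))%:M 0 0 P *m schur_shear A).
rewrite {1}(schur_decomposition pA) trmx_mul !mulmxA; congr (_ *m _).
rewrite -mulmxA; congr (_ *m _).
rewrite eP; exact: gram_block.
Qed.

Lemma det_schur (R : realType) n (A : 'M[R]_(1 + n)) :
  posdef A -> \det A = A 0 0 * \det (schur_compl A).
Proof.
move=> pA; rewrite {1}(schur_decomposition pA) !det_mulmx det_tr !det_ublock.
by rewrite !det1 !mulr1 !mul1r det_scalar1.
Qed.

Lemma mxtrace_schur (R : realType) n (A : 'M[R]_(1 + n)) :
  posdef A -> A 0 0 + \tr (schur_compl A) <= \tr A.
Proof.
move=> /posdef_corner_gt0 a0.
rewrite -{3}[A]submxK mxtrace_block trace_mx11 /schur_compl.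
rewrite linearB /= linearZ /= !mxE !lshift0 lerD2l gerBl.
apply: mulr_ge0; first by rewrite invr_ge0 ltW.
exact: mxtrace_gram_ge0.
Qed.

(** Summing ln t <= t - 1 over the pivots of the elimination; the pivots add up
to at most the trace, since every Schur complement subtracts a Gram matrix. *)
Lemma posdef_det (R : realType) n (A : 'M[R]_n) :
  posdef A -> 0 < \det A /\ ln (\det A) <= \tr A - n%:R.
Proof.
elim: n A => [|n IH] A pA.
  by rewrite det_mx00 ln1 ltr01 subr0 /mxtrace big_ord0.
have a0 := posdef_corner_gt0 pA.
have [dS lS] := IH _ (schur_compl_posdef pA).
have dE := det_schur pA; have tE := mxtrace_schur pA.
rewrite dE mulr_gt0 //; split=> //.
rewrite lnM ?posrE //.
have la : ln (A 0 0) <= A 0 0 - 1.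
  by rewrite -{1}[A 0 0](subrK 1) addrC le_ln1Dx //; lra.
by rewrite -natr1; lra.
Qed.

Lemma posdef_unitmx (R : realType) n (A : 'M[R]_n) : posdef A -> A \in unitmx.
Proof.
by move=> /posdef_det[dA _]; rewrite unitmxE unitfE gt_eqF.
Qed.

(** Concavity of ln det, in the form of its tangent inequality at A: with
A = P^T P it is [posdef_det] for the matrix P^-T B P^-1. *)
Lemma ln_det_le (R : realType) n (A B : 'M[R]_n) :
  posdef A -> posdef B ->
  ln (\det B) - ln (\det A) <= \tr (invmx A *m B) - n%:R.
Proof.
move=> pA pB; have uA := posdef_unitmx pA.
have [P eP] := posdef_factor pA.
have uP : P \in unitmx.
  by move: uA; rewrite eP unitmx_mul unitmx_tr => /andP[].
have uQ : invmx P \in unitmx by rewrite unitmx_inv.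
have [_ ] := posdef_det (posdef_congr uQ pB).
have [dA _] := posdef_det pA; have [dB _] := posdef_det pB.
have -> : \tr ((invmx P)^T *m B *m invmx P) = \tr (invmx A *m B).
  rewrite mxtrace_mulC mulmxA; congr (\tr (_ *m _)).
  apply: (can_inj (mulmxK uA)); rewrite mulVmx // eP trmx_inv -mulmxA.
  by rewrite (mulmxA (invmx P^T)) mulVmx ?unitmx_tr // mul1mx mulVmx.
have -> : \det ((invmx P)^T *m B *m invmx P) = \det B / \det A.
  rewrite eP !det_mulmx !det_tr det_inv invfM.
  by rewrite mulrC mulrCA mulrA mulrC.
by rewrite ln_div // posrE.
Qed.

Lemma dot_sym (R : realType) n (u v : 'cV[R]_n) :
  (u^T *m v) 0 0 = (v^T *m u) 0 0.
Proof. by rewrite -[in RHS](trmxK u) -trmx_mul [RHS]mxE. Qed.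

Lemma posdef_inv (R : realType) n (A : 'M[R]_n) :
  posdef A -> posdef (invmx A).
Proof.
move=> pA; have uA := posdef_unitmx pA; have [symA _] := pA.
have := posdef_congr (etrans (unitmx_inv A) uA) pA.
by rewrite trmx_inv symA mulVmx // mul1mx.
Qed.

Lemma posdef_ge0 (R : realType) n (A : 'M[R]_n) (v : 'cV[R]_n) :
  posdef A -> 0 <= (v^T *m A *m v) 0 0.
Proof.
move=> [_ posA]; have [->|/posA/ltW //] := eqVneq v 0.
by rewrite mulmx0 mxE.
Qed.

(** The quadratic form of A is nonnegative at k v - s A^-1 x, where
k = x^T A^-1 x and s = x^T v; this vector is, up to the factor k, the component
of v that is A-orthogonal to A^-1 x. *)
Lemma posdef_CauchySchwarz (R : realType) n (A : 'M[R]_n) (x v : 'cV[R]_n) :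
  posdef A -> x != 0 ->
  (x^T *m v) 0 0 ^+ 2 <= (x^T *m invmx A *m x) 0 0 * (v^T *m A *m v) 0 0.
Proof.
move=> pA x0; have uA := posdef_unitmx pA.
have [symA _] := pA; have symI : (invmx A)^T = invmx A.
  by rewrite trmx_inv symA.
have k0 : 0 < (x^T *m invmx A *m x) 0 0 by apply: (posdef_inv pA).2.
set k := (x^T *m invmx A *m x) 0 0 in k0 *.
set s := (x^T *m v) 0 0; set q := (v^T *m A *m v) 0 0.
have := posdef_ge0 (k *: v - s *: (invmx A *m x)) pA.
suff -> : ((k *: v - s *: (invmx A *m x))^T *m A
             *m (k *: v - s *: (invmx A *m x))) 0 0 = k * (k * q - s ^+ 2).
  by rewrite pmulr_rge0 // subr_ge0.
have vx : (v^T *m x) 0 0 = s by exact: dot_sym.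
set y := invmx A *m x.
have Ay : A *m y = x by rewrite mulKVmx.
have yA : y^T *m A = x^T by rewrite -[in LHS]symA -trmx_mul Ay.
have trE : (k *: v - s *: y)^T = k *: v^T - s *: y^T.
  by rewrite linearB /= !linearZ.
rewrite trE !mulmxBl !mulmxBr -!scalemxAl -!scalemxAr -!mulmxA !Ay.
rewrite !(mulmxA _ A v) yA.
have yx : (y^T *m x) 0 0 = k by rewrite dot_sym /k mulmxA.
have e1 (M N : 'M[R]_1) : (M - N) 0 0 = M 0 0 - N 0 0 by rewrite !mxE.
have e2 c (M : 'M[R]_1) : (c *: M) 0 0 = c * M 0 0 by rewrite !mxE.
rewrite !(e1, e2) yx vx -/s -/q; ring.
Qed.

Lemma quad_rank1 (R : realType) n (x v : 'cV[R]_n) :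
  (v^T *m (x *m x^T) *m v) 0 0 = (x^T *m v) 0 0 ^+ 2.
Proof.
by rewrite mulmxA -mulmxA mxE big_ord1 expr2 (dot_sym v x).
Qed.

(** For l < 0 the Cauchy-Schwarz inequality bounds the loss l (x^T v)^2 by
the fraction - l x^T A^-1 x < 1 of v^T A v. *)
Lemma posdef_rank1 (R : realType) n (A : 'M[R]_n) (x : 'cV[R]_n) (l : R) :
  posdef A -> x != 0 -> 0 < 1 + l * (x^T *m invmx A *m x) 0 0 ->
  posdef (A + l *: (x *m x^T)).
Proof.
move=> pA x0 lk; have [symA posA] := pA; split.
  by rewrite linearD /= linearZ /= trmx_mul trmxK symA.
move=> v v0; have CS := posdef_CauchySchwarz v pA x0.
have q0 := posA v v0.
have -> : (v^T *m (A + l *: (x *m x^T)) *m v) 0 0 =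
    (v^T *m A *m v) 0 0 + l * (x^T *m v) 0 0 ^+ 2.
  rewrite mulmxDr mulmxDl -scalemxAr -scalemxAl mxE; congr (_ + _).
  by rewrite mxE quad_rank1.
have [l0|l0] := leP 0 l; first by rewrite ltr_wpDr // mulr_ge0 // sqr_ge0.
nra.
Qed.

(** The matrix determinant lemma: both sides are the determinant of the block
matrix [A, - l x; x^T, 1], eliminated from either corner. *)
Lemma det_rank1 (R : realType) n (A : 'M[R]_n) (x : 'cV[R]_n) (l : R) :
  A \in unitmx ->
  \det (A + l *: (x *m x^T)) =
    \det A * (1 + l * (x^T *m invmx A *m x) 0 0).
Proof.
move=> uA.
have e1 : block_mx (A + l *: (x *m x^T)) (- l *: x) 0 1%:M
       *m block_mx 1%:M 0 x^T 1%:M = block_mx A (- l *: x) x^T 1%:M.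
  rewrite mulmx_block !(mulmx1, mulmx0, mul0mx, mul1mx, add0r) -scalemxAl.
  by rewrite scaleNr addrK.
pose c := 1 + l * (x^T *m invmx A *m x) 0 0.
have e2 : block_mx A 0 x^T 1%:M
       *m block_mx 1%:M (- l *: (invmx A *m x)) 0 c%:M =
    block_mx A (- l *: x) x^T 1%:M.
  rewrite mulmx_block !(mulmx1, mulmx0, mul0mx, mul1mx, addr0) -!scalemxAr.
  rewrite mulKVmx //; congr (block_mx _ _ _ _).
  rewrite mulmxA [x^T *m invmx A *m x]mx11_scalar /c; set k := _ 0 0.
  rewrite scale_scalar_mx -raddfD /=; congr (_%:M); ring.
have := congr1 determinant (etrans e1 (esym e2)).
rewrite !det_mulmx !det_ublock !det_lblock !det1 det_scalar1.
by rewrite !mulr1 !mul1r.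
Qed.

(** * The design matrix and the variances kappa *)

Lemma XUXT_sum (R : realType) n m (X : 'M[R]_(n, m)) (u : 'rV[R]_m) :
  XUXT X u = \sum_i u 0 i *: (col i X *m (col i X)^T).
Proof.
apply/matrixP => i j; rewrite summxE /XUXT mul_mx_diag mxE.
apply: eq_bigr => k _; rewrite !mxE big_ord1 !mxE.
by rewrite mulrA [_ * u _ _]mulrC.
Qed.

Lemma XUXT_sym (R : realType) n m (X : 'M[R]_(n, m)) (u : 'rV[R]_m) :
  (XUXT X u)^T = XUXT X u.
Proof. by rewrite /XUXT !trmx_mul trmxK tr_diag_mx mulmxA. Qed.

Lemma XUXT_update (R : realType) n m (X : 'M[R]_(n, m)) (u : 'rV[R]_m) l j :
  XUXT X (u + l *: delta_mx 0 j) =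
  XUXT X u + l *: (col j X *m (col j X)^T).
Proof.
rewrite !XUXT_sum (bigD1 j) //= [in RHS](bigD1 j) //=.
rewrite !mxE !eqxx mulr1 scalerDl addrAC; congr (_ + _ + _).
by apply: eq_bigr => i /negPf ij; rewrite !mxE ij andbF mulr0 addr0.
Qed.

Lemma mxtrace_XUXT (R : realType) n m (X : 'M[R]_(n, m)) (u v : 'rV[R]_m) :
  \tr (invmx (XUXT X u) *m XUXT X v) = \sum_i v 0 i * kappa X u i.
Proof.
rewrite (XUXT_sum X v) mulmx_sumr linear_sum /=; apply: eq_bigr => i _.
rewrite -scalemxAr linearZ /=; congr (_ * _).
by rewrite mulmxA mxtrace_mulC trace_mx11 mulmxA.
Qed.

Lemma sum_kappa (R : realType) n m (X : 'M[R]_(n, m)) (u : 'rV[R]_m) :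
  posdef (XUXT X u) -> \sum_i u 0 i * kappa X u i = n%:R.
Proof.
by move=> /posdef_unitmx uA; rewrite -mxtrace_XUXT mulVmx // mxtrace1.
Qed.

Lemma kappa_gt0 (R : realType) n m (X : 'M[R]_(n, m)) (u : 'rV[R]_m) i :
  posdef (XUXT X u) -> col i X != 0 -> 0 < kappa X u i.
Proof. by move=> pA xi0; apply: (posdef_inv pA).2. Qed.

(** A vector on which the form vanishes is orthogonal to every point, hence to
their span, hence to itself. *)
Lemma posdef_of_span (R : realType) n m (X : 'M[R]_(n, m)) (u : 'rV[R]_m) :
  points_span X predT -> (forall i, 0 < u 0 i) -> posdef (XUXT X u).
Proof.
move=> Xspan u0; split; first exact: XUXT_sym.
move=> v v0.
have qE : (v^T *m XUXT X u *m v) 0 0 =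
    \sum_i u 0 i * ((col i X)^T *m v) 0 0 ^+ 2.
  rewrite XUXT_sum mulmx_sumr mulmx_suml summxE; apply: eq_bigr => i _.
  by rewrite -scalemxAr -scalemxAl mxE quad_rank1.
have t0 i : 0 <= u 0 i * ((col i X)^T *m v) 0 0 ^+ 2.
  by rewrite mulr_ge0 ?sqr_ge0 // ltW.
rewrite lt_neqAle qE sumr_ge0 // andbT eq_sym.
apply: contra v0 => /eqP s0.
have orth i : (col i X)^T *m v = 0.
  apply/matrixP => a b; rewrite !ord1 [RHS]mxE; apply/eqP.
  have /eqP := s0; rewrite psumr_eq0 // => /allP/(_ i).
  rewrite mem_index_enum => /(_ isT).
  by rewrite mulf_eq0 gt_eqF //= sqrf_eq0.
have vin : v \in <<[seq col i X | i : 'I_m in predT]>>%VS.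
  by rewrite Xspan memvf.
have vv : v^T *m v = 0.
  rewrite {1}(coord_span (X := in_tuple _) vin) linear_sum mulmx_suml.
  apply: big1 => k _; rewrite linearZ /= -scalemxAl.
  have /mapP[i _ ->] : (in_tuple [seq col i X | i : 'I_m in predT])`_k
     \in [seq col i X | i : 'I_m in predT] by apply: mem_nth.
  by rewrite orth scaler0.
apply/eqP/matrixP => i j; rewrite !ord1 [RHS]mxE.
have /eqP := congr1 (fun M : 'M[R]_1 => M 0 0) vv.
rewrite !mxE psumr_eq0; last by move=> k _; rewrite mxE -expr2 sqr_ge0.
move=> /allP/(_ i); rewrite mem_index_enum => /(_ isT).
by rewrite mxE mulf_eq0 orbb => /eqP.
Qed.

(** * Scalar estimates for one step *)

(** The derivative of the difference of the two sides is
(x - 1)^2 / (x (x + 1)^2). The first-order bound ln x >= 1 - 1 / x would lose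
the quadratic term on which the rate of convergence depends. *)
Lemma ln_ge_pade (R : realType) (x : R) :
  1 <= x -> 2 * (x - 1) / (x + 1) <= ln x.
Proof.
rewrite le_eqVlt => /predU1P[<-|x1]; first by rewrite subrr mulr0 mul0r ln1.
pose f (y : R) := ln y + 4 * (y + 1)^-1.
have fd (y : R) : 0 < y -> is_derive y 1 f (y^-1 - 4 / (y + 1) ^+ 2).
  move=> y0; have y10 : y + 1 != 0 by rewrite gt_eqF // addr_gt0.
  have d1 : is_derive y (1 : R) (fun z : R => z + 1) 1.
    by rewrite -[X in is_derive _ _ _ X]addr0; exact: is_deriveD.
  have d2 := is_deriveV (f := fun z : R => z + 1) y10 d1.
  have d3 := is_derive1_ln y0.
  have := is_deriveD d3 (is_deriveZ 4 d2).
  move=> d4; apply: (is_derive_eq d4); by rewrite /GRing.scale /= mulr1 mulrN.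
have [||c] := MVT x1 (f := f) (df := fun y : R => y^-1 - 4 / (y + 1) ^+ 2).
- move=> y; rewrite in_itv /= => /andP[y1 _].
  exact/fd/(lt_trans ltr01 y1).
- apply: derivable_within_continuous => y; rewrite in_itv /= => /andP[y1 _].
  by have [] := fd y (lt_le_trans ltr01 y1).
rewrite in_itv /= => /andP[c1 _]; rewrite /f ln1 add0r => E.
have c0 : 0 < c := lt_trans ltr01 c1.
have d0 : 0 <= c^-1 - 4 / (c + 1) ^+ 2.
  have -> : c^-1 - 4 / (c + 1) ^+ 2 = (c - 1) ^+ 2 / (c * (c + 1) ^+ 2).
    by field; rewrite !gt_eqF // ?addr_gt0.
  by rewrite divr_ge0 ?sqr_ge0 // mulr_ge0 ?sqr_ge0 // ltW.
have : 0 <= ln x + 4 * (x + 1)^-1 - 2.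
  have -> : 2 = 4 * (1 + 1)^-1 :> R by field.
  by rewrite E mulr_ge0 // subr_ge0 ltW.
have -> : 2 * (x - 1) / (x + 1) = 2 - 4 * (x + 1)^-1.
  by field; rewrite gt_eqF // addr_gt0 // (lt_trans ltr01).
lra.
Qed.

(** A single lower bound for the decrease of the objective at optimality error
e. It is quadratic for small e, it tends to 4/9 < ln 2 for large e, and its
reciprocal 8 / e^2 + 9/4 is easy to integrate. *)
Definition descent_rate (R : realType) (e : R) : R :=
  e ^+ 2 / (8 + 9 / 4 * e ^+ 2).

Lemma descent_rate_ge0 (R : realType) (e : R) : 0 <= descent_rate e.
Proof.
by rewrite divr_ge0 ?sqr_ge0 // addr_ge0 // mulr_ge0 ?sqr_ge0.
Qed.

(** With kappa_+ = (1 + e) n, the step length (kappa_+ - n) / kappa_+^2 changes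
the objective by exactly - (ln (1 + t) - t (1 - t)), where
t = 1 - n / kappa_+. The rational bound for ln reduces the claim to the
positivity of a cubic in e. *)
Lemma descent_rate_le_increase (R : realType) (e : R) : 0 <= e ->
  let t := e / (1 + e) in descent_rate e <= ln (1 + t) - t * (1 - t).
Proof.
move=> e0 /=; set t := e / (1 + e).
have t0 : 0 <= t by rewrite divr_ge0 // addr_ge0.
have : 1 <= 1 + t by rewrite lerDl.
move/ln_ge_pade => lnt.
suff : descent_rate e <= 2 * (1 + t - 1) / (1 + t + 1) - t * (1 - t) by lra.
have e1 : 0 < 1 + e by lra.
have e2 : 0 < 2 + 3 * e by lra.
have e3 : 0 < 8 + 9 / 4 * e ^+ 2 by have := sqr_ge0 e; lra.
have -> : 2 * (1 + t - 1) / (1 + t + 1) - t * (1 - t) =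
    e ^+ 2 * ((1 + 2 * e) / ((1 + e) ^+ 2 * (2 + 3 * e))).
  by rewrite /t; field; rewrite !gt_eqF.
rewrite /descent_rate; apply: ler_wpM2l; first exact: sqr_ge0.
rewrite ler_pdivlMr; last by rewrite mulr_gt0 // exprn_gt0.
rewrite mulrC ler_pdivrMr // -subr_ge0.
have -> : (1 + 2 * e) * (8 + 9 / 4 * e ^+ 2) - (1 + e) ^+ 2 * (2 + 3 * e)
  = 6 + e * (3 / 2 * (e - 23 / 12) ^+ 2 + 335 / 96) by field.
have q0 := sqr_ge0 (e - 23 / 12).
by apply: addr_ge0 => //; apply: mulr_ge0 => //; lra.
Qed.

(** Here kappa_- = (1 - e) n and the step goes to the exact minimizer along its
coordinate. With r^2 = 1 / (1 - e), the estimate ln r <= r - 1 leaves the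
square (r - 1)^2, and e <= 2 (r - 1). *)
Lemma descent_rate_le_decrease (R : realType) (e : R) : 0 <= e -> e < 1 ->
  descent_rate e <= ln (1 - e) + (1 - e)^-1 - 1.
Proof.
move=> e0 e1; have w0 : 0 < 1 - e by rewrite subr_gt0.
set r := Num.sqrt (1 - e)^-1.
have r2 : r ^+ 2 = (1 - e)^-1 by rewrite sqr_sqrtr // invr_ge0 ltW.
have rgt : 0 < r by rewrite sqrtr_gt0 invr_gt0.
have lnE : ln (1 - e) = - (ln r *+ 2).
  by rewrite -lnXn // r2 lnV ?posrE // opprK.
have lnr : ln r <= r - 1.
  by rewrite -{1}[r](subrK 1) addrC le_ln1Dx //; lra.
have re : (1 - e) * r ^+ 2 = 1 by rewrite r2 mulfV // gt_eqF.
have e2r : e <= 2 * (r - 1).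
  rewrite -subr_ge0 -(pmulr_lge0 _ (exprn_gt0 2 rgt)).
  have -> : (2 * (r - 1) - e) * r ^+ 2 = (r - 1) ^+ 2 * (2 * r + 1).
    have -> : (2 * (r - 1) - e) * r ^+ 2 =
      2 * (r - 1) * r ^+ 2 - r ^+ 2 + (1 - e) * r ^+ 2 by ring.
    rewrite re; ring.
  by rewrite mulr_ge0 ?sqr_ge0 //; lra.
have rate8 : descent_rate e <= e ^+ 2 / 8.
  rewrite /descent_rate ler_wpM2l ?sqr_ge0 // lef_pV2 ?posrE //.
  - by have := sqr_ge0 e; lra.
  - by have := sqr_ge0 e; lra.
have e4 : e ^+ 2 <= 4 * (r - 1) ^+ 2 by nra.
rewrite lnE -r2 mulr2n.
have -> : r ^+ 2 = (r - 1) ^+ 2 + 2 * (r - 1) + 1 by ring.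
have := sqr_ge0 (r - 1); lra.
Qed.

(** A drop stops short of the minimizer along its coordinate, so it does not
increase the objective; with y = u_j kappa_j and c = kappa_j / n this is the
needed inequality. *)
Lemma Nln_1B_le (R : realType) (y c : R) : 0 < c -> 0 <= y -> y <= 1 - c ->
  - ln (1 - y) <= y / c.
Proof.
move=> c0 y0 yc; have y1 : 0 < 1 - y by lra.
rewrite -lnV ?posrE //.
have -> : (1 - y)^-1 = 1 + y / (1 - y) by field; rewrite gt_eqF.
apply: (@le_trans _ _ (y / (1 - y))).
  by apply: le_ln1Dx; apply: (lt_le_trans (ltrN10 R)); rewrite divr_ge0 // ltW.
by apply: ler_wpM2l => //; rewrite lef_pV2 ?posrE //; lra.
Qed.

(** * The objective along the run *)

Definition design_obj (R : realType) n m (X : 'M[R]_(n, m))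
    (u : 'rV[R]_m) : R :=
  - ln (\det (XUXT X u)) + n%:R * (\sum_i u 0 i - 1).

Definition supp_size (R : realType) m (u : 'rV[R]_m) : nat :=
  #|[pred i | u 0 i != 0]|.

(** The tangent inequality for ln det, with A(v) rescaled by 1 / c so that a
bound kappa(u) <= c n can be used at full strength. *)
Lemma ln_det_XUXT_le (R : realType) n m (X : 'M[R]_(n, m)) (u v : 'rV[R]_m) c :
  posdef (XUXT X u) -> posdef (XUXT X v) -> 0 < c ->
  ln (\det (XUXT X v)) - ln (\det (XUXT X u)) <=
    n%:R * ln c + (\sum_i v 0 i * kappa X u i) / c - n%:R.
Proof.
move=> pu pv c0; have ci : 0 < c^-1 by rewrite invr_gt0.
have := ln_det_le pu (posdefZ ci pv).
have [dv _] := posdef_det pv.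
rewrite detZ -scalemxAr linearZ /= mxtrace_XUXT lnM ?posrE ?exprn_gt0 //.
rewrite lnXn // lnV ?posrE // mulNrn -[ln c *+ n]mulr_natl mulrC; lra.
Qed.

(** Weak duality: A(u)^-1 / c is feasible for the dual problem when
kappa(u) <= c n. *)
Lemma design_obj_gap (R : realType) n m (X : 'M[R]_(n, m)) (u v : 'rV[R]_m) c :
  posdef (XUXT X u) -> posdef (XUXT X v) -> 0 < c ->
  (forall i, 0 <= v 0 i) -> (forall i, kappa X u i <= c * n%:R) ->
  design_obj X u - design_obj X v <= n%:R * (ln c + (\sum_i u 0 i - 1)).
Proof.
move=> pu pv c0 v0 kc; have := ln_det_XUXT_le pu pv c0.
have : (\sum_i v 0 i * kappa X u i) / c <= n%:R * \sum_i v 0 i.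
  rewrite ler_pdivrMr // mulr_sumr mulr_suml; apply: ler_sum => i _.
  have -> : n%:R * v 0 i * c = v 0 i * (c * n%:R) by ring.
  exact: ler_wpM2l.
rewrite /design_obj; lra.
Qed.

Lemma posdef_update (R : realType) n m (X : 'M[R]_(n, m)) (u : 'rV[R]_m) l j :
  posdef (XUXT X u) -> col j X != 0 -> 0 < 1 + l * kappa X u j ->
  posdef (XUXT X (u + l *: delta_mx 0 j)).
Proof. by move=> pu xj lk; rewrite XUXT_update; exact: posdef_rank1. Qed.

Lemma sum_update (R : realType) m (u : 'rV[R]_m) l j :
  \sum_i (u + l *: delta_mx 0 j) 0 i = \sum_i u 0 i + l.
Proof.
under eq_bigr do rewrite !mxE eqxx /=.
rewrite big_split /= -mulr_sumr; congr (_ + _).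
by rewrite (bigD1 j) //= eqxx big1 ?addr0 ?mulr1 // => i /negPf->.
Qed.

Lemma design_obj_update (R : realType) n m (X : 'M[R]_(n, m)) (u : 'rV[R]_m)
    l j :
  posdef (XUXT X u) -> 0 < 1 + l * kappa X u j ->
  design_obj X (u + l *: delta_mx 0 j) =
  design_obj X u - ln (1 + l * kappa X u j) + n%:R * l.
Proof.
move=> pu lk; have [du _] := posdef_det pu.
rewrite /design_obj sum_update XUXT_update det_rank1 ?posdef_unitmx //.
rewrite -/(kappa X u j) lnM ?posrE //; ring.
Qed.

Lemma row_replaceE (R : realType) m (u : 'rV[R]_m) j (w : R) :
  \row_i (if i == j then w else u 0 i) = u + (w - u 0 j) *: delta_mx 0 j.
Proof.
apply/rowP => i; rewrite !mxE eqxx /=; case: eqVneq => [->|_] /=.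
  by rewrite mulr1 addrC subrK.
by rewrite mulr0 addr0.
Qed.

Lemma supp_size_update (R : realType) m (u : 'rV[R]_m) l j :
  (supp_size (u + l *: delta_mx 0%R j) <= (supp_size u).+1)%N.
Proof.
rewrite /supp_size.
apply: (@leq_trans #|[predU1 j & [pred i | u 0%R i != 0%R]]|); last first.
  by rewrite cardU1 -[X in (_ <= X)%N]add1n leq_add2r leq_b1.
apply/subset_leq_card/fintype.subsetP => i; rewrite !inE !mxE eqxx /=.
by case: (eqVneq i j) => //= _; rewrite mulr0 addr0.
Qed.

Lemma supp_size_drop (R : realType) m (u : 'rV[R]_m) j : u 0 j != 0 ->
  (supp_size (u - u 0%R j *: delta_mx 0%R j) < supp_size u)%N.
Proof.
move=> uj; apply/proper_card/properP; split.
  apply/fintype.subsetP => i; rewrite !inE !mxE eqxx /=.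
  by case: (eqVneq i j) => [->|_] //=; rewrite mulr0 subr0.
by exists j; rewrite !inE // !mxE !eqxx mulr1 subrr eqxx.
Qed.

(** The dichotomy that drives the count. The number e is the optimality error of
u, attained at the chosen coordinate. The first alternative collects the
increases and the decreases that reach their minimizer; the second is a drop,
which can only happen while n - kappa_- dominates, so that e < 1. *)
Lemma cd_step_descent (R : realType) n m (X : 'M[R]_(n, m)) (u u' : 'rV[R]_m) :
  (forall i, col i X != 0) ->
  (forall i, 0 <= u 0 i) -> posdef (XUXT X u) -> cd_step X u u' ->
  [/\ forall i, 0 <= u' 0 i, posdef (XUXT X u') &
      exists e, [/\ 0 <= e, approx_optimal e X u &
        (design_obj X u' <= design_obj X u - descent_rate e
           /\ (supp_size u' <= (supp_size u).+1)%N) \/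
        [/\ e < 1, design_obj X u' <= design_obj X u &
            (supp_size u' < supp_size u)%N] ]].
Proof.
move=> X0 u0 pu [jp [jm /= [kpmax ujm kmmin u'E]]].
have kp0 := kappa_gt0 pu (X0 jp); have km0 := kappa_gt0 pu (X0 jm).
set kp := kappa X u jp in kp0 kpmax u'E.
set km := kappa X u jm in km0 kmmin u'E.
have kmp : km <= kp := kpmax jm.
have n0 : 0 < n%:R :> R.
  rewrite ltr0n lt0n; apply/negP => /eqP n0.
  have /eqP[] := X0 jm; apply/matrixP => -[i lin]; exfalso.
  by move: lin; rewrite n0.
have [cond|cond] := leP (n%:R - km) (kp - n%:R).
  have nkp : n%:R <= kp by lra.
  pose e := kp / n%:R - 1.
  have e0 : 0 <= e by rewrite subr_ge0 ler_pdivlMr // mul1r.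
  have eE : (1 + e) * n%:R = kp by rewrite /e; field; rewrite gt_eqF.
  pose l := (kp - n%:R) / kp ^+ 2.
  have l0 : 0 <= l by rewrite divr_ge0 ?sqr_ge0 // subr_ge0.
  have lk : 0 < 1 + l * kp by rewrite ltr_wpDr // mulr_ge0 // ltW.
  rewrite {}u'E cond -/l; split.
  - move=> i; rewrite !mxE; apply: addr_ge0 => //.
    by rewrite mulr_ge0 // ler0n.
  - exact: posdef_update.
  - exists e; split=> //.
      split; first by split=> // i; rewrite eE.
      by move=> i /kmmin; apply: le_trans; lra.
    left; split; last exact: supp_size_update.
    rewrite design_obj_update // -/kp.
    have := descent_rate_le_increase e0; rewrite /=.
    have -> : e / (1 + e) = l * kp.
      by rewrite /e /l; field; rewrite !gt_eqF.
    have -> : l * kp * (1 - l * kp) = n%:R * l.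
      by rewrite /l; field; rewrite !gt_eqF.
    lra.
have kmn : km < n%:R by lra.
pose e := 1 - km / n%:R.
have e0 : 0 <= e by rewrite subr_ge0 ler_pdivrMr // mul1r ltW.
have e1 : e < 1 by rewrite /e gtrBl divr_gt0.
have eE : (1 - e) * n%:R = km by rewrite /e; field; rewrite gt_eqF.
have apx : approx_optimal e X u.
  split; first split=> // i; first by apply: le_trans (kpmax i) _; lra.
  by move=> i /kmmin; rewrite eE.
pose l := (n%:R - km) / (n%:R * km).
have l0 : 0 <= l.
  by rewrite divr_ge0 ?mulr_ge0 ?(ltW n0) ?(ltW km0) // subr_ge0 ltW.
have lkE : l * km = e by rewrite /l /e; field; rewrite !gt_eqF.
rewrite {}u'E leNgt cond /= row_replaceE -/l.
have [lu|ul] := leP l (u 0 jm).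
  have -> : Num.max (u 0 jm - l) 0 = u 0 jm - l.
    by apply: max_l; rewrite subr_ge0.
  have -> : u 0 jm - l - u 0 jm = - l by ring.
  have lk : 0 < 1 + - l * km by rewrite mulNr lkE subr_gt0.
  split.
  - move=> i; rewrite !mxE eqxx /=; case: eqVneq => [->|_].
      by rewrite mulr1 subr_ge0.
    by rewrite mulr0 addr0.
  - exact: posdef_update.
  - exists e; split=> //; left; split; last exact: supp_size_update.
    rewrite design_obj_update // -/km.
    have := descent_rate_le_decrease e0 e1; rewrite mulNr lkE.
    have : (1 - e)^-1 - 1 = n%:R * l.
      by rewrite /e /l; field; rewrite !gt_eqF // subr_gt0.
    lra.
have -> : Num.max (u 0 jm - l) 0 = 0.
  by apply: max_r; rewrite subr_le0 ltW.
rewrite sub0r.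
have y0 : 0 <= u 0 jm * km by rewrite mulr_ge0 // ltW.
have ye : u 0 jm * km <= 1 - km / n%:R.
  by rewrite -/e -lkE ler_wpM2r // ltW.
have kn0 : 0 < km / n%:R by rewrite divr_gt0.
have lk : 0 < 1 + - u 0 jm * km by rewrite mulNr; lra.
split.
- move=> i; rewrite !mxE eqxx /=; case: eqVneq => [->|_].
    by rewrite mulr1 subrr.
  by rewrite mulr0 addr0.
- exact: posdef_update.
- exists e; split=> //; right; split=> //; last first.
    by rewrite scaleNr; apply: supp_size_drop; rewrite gt_eqF.
  rewrite design_obj_update // -/km mulNr.
  have := Nln_1B_le kn0 y0 ye.
  have -> : u 0 jm * km / (km / n%:R) = n%:R * u 0 jm.
    by field; rewrite !gt_eqF.
  lra.
Qed.

(** * Counting the steps *)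

(** The primitive, vanishing at 0, of the function 1 / max(1, y)^2. *)
Definition recip_profile (R : realType) (y : R) : R :=
  if y <= 1 then y else 2 - y^-1.

Lemma recip_profile_le2 (R : realType) (y : R) : recip_profile y <= 2.
Proof.
rewrite /recip_profile; case: (leP y 1) => [|y1]; first lra.
by rewrite gerBl invr_ge0; lra.
Qed.

Lemma recip_profile_ge0 (R : realType) (y : R) : 0 <= y -> 0 <= recip_profile y.
Proof.
move=> y0; rewrite /recip_profile; case: (leP y 1) => // y1.
have : y^-1 < 1 by rewrite invf_lt1 // (lt_trans ltr01).
lra.
Qed.

(** Concavity, as a tangent inequality: the slope of the function at any point
up to z is at least 1 / z^2. *)
Lemma recip_profile_drop (R : realType) (y y' z : R) :
  y' <= y -> 1 <= z -> y <= z ->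
  recip_profile y' <= recip_profile y - (y - y') / z ^+ 2.
Proof.
move=> yy z1 yz.
have z0 : 0 < z by lra.
have zz : 1 <= z ^+ 2 by rewrite exprn_ege1.
have q1 : (y - y') / z ^+ 2 <= y - y'.
  by rewrite ler_pdivrMr ?exprn_gt0 // ler_peMr // subr_ge0.
rewrite /recip_profile; case: (leP y 1) => y1.
  by rewrite (le_trans yy y1); lra.
have y0 : 0 < y by lra.
have q2 : (y - y') / z ^+ 2 <= (y - y') / y ^+ 2.
  rewrite ler_wpM2l ?subr_ge0 // lef_pV2 ?posrE ?exprn_gt0 //.
  by rewrite lerXn2r ?nnegrE // ltW.
apply: (@le_trans _ _ (2 - y^-1 - (y - y') / y ^+ 2)); last lra.
case: (leP y' 1) => y1'.
  rewrite -subr_ge0.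
  have -> : 2 - y^-1 - (y - y') / y ^+ 2 - y' =
     (1 - y^-1) ^+ 2 + (1 - y') * (1 - y^-1) * (1 + y^-1).
    by field; rewrite gt_eqF.
  have yi : 0 < y^-1 <= 1 by rewrite invr_gt0 y0 invf_le1 // ltW.
  by rewrite addr_ge0 ?sqr_ge0 // !mulr_ge0 //; lra.
have y0' : 0 < y' by lra.
rewrite -subr_ge0.
have -> : 2 - y^-1 - (y - y') / y ^+ 2 - (2 - y'^-1) =
    (y - y') ^+ 2 / (y' * y ^+ 2).
  by field; rewrite !gt_eqF.
by rewrite divr_ge0 ?sqr_ge0 // mulr_ge0 ?sqr_ge0 // ltW.
Qed.

(** The primitive in d of 8 / max(eps, d / C)^2 + 9/4, an upper bound for the
number of steps that the gap d can pay for. *)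
Definition potential (R : realType) (C eps d : R) : R :=
  8 * C / eps * recip_profile (d / (C * eps)) + 9 / 4 * d.

Lemma potential_ge0 (R : realType) (C eps d : R) :
  0 < C -> 0 < eps -> 0 <= d -> 0 <= potential C eps d.
Proof.
move=> C0 e0 d0; rewrite /potential addr_ge0 //; last by rewrite mulr_ge0.
rewrite mulr_ge0 //; first by rewrite divr_ge0 ?mulr_ge0 // ltW.
by rewrite recip_profile_ge0 // divr_ge0 // mulr_ge0 // ltW.
Qed.

Lemma potential_le (R : realType) (C eps d : R) :
  0 < C -> 0 < eps -> potential C eps d <= 16 * C / eps + 9 / 4 * d.
Proof.
move=> C0 e0; rewrite lerD2r.
have -> : 16 * C / eps = 8 * C / eps * 2 by field; rewrite gt_eqF.
by rewrite ler_wpM2l ?recip_profile_le2 // divr_ge0 ?mulr_ge0 // ltW.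
Qed.

(** The potential is concave, and its slope at the gap d is at least
8 / z^2 + 9/4 because max(eps, d / C) <= z. *)
Lemma potential_drop (R : realType) (C eps d d' z : R) :
  0 < C -> 0 < eps -> d' <= d -> eps <= z -> d <= C * z ->
  potential C eps d' <= potential C eps d - (d - d') * (8 / z ^+ 2 + 9 / 4).
Proof.
move=> C0 e0 dd ez dz; have z0 := lt_le_trans e0 ez.
have Ce : 0 < C * eps by rewrite mulr_gt0.
have k0 : 0 < 8 * C / eps by rewrite divr_gt0 // mulr_gt0.
have := @recip_profile_drop R (d / (C * eps)) (d' / (C * eps)) (z / eps).
rewrite ler_pM2r ?invr_gt0 // => /(_ dd).
rewrite ler_pdivlMr // mul1r => /(_ ez).
rewrite ler_pdivrMr //.
have -> : z / eps * (C * eps) = C * z by field; rewrite gt_eqF.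
move=> /(_ dz); rewrite -(ler_pM2l k0) mulrBr.
have -> : 8 * C / eps * ((d / (C * eps) - d' / (C * eps)) / (z / eps) ^+ 2)
  = (d - d') * (8 / z ^+ 2).
  by field; rewrite !gt_eqF.
rewrite /potential; lra.
Qed.

Lemma potential_step (R : realType) (C eps d d' e : R) :
  0 < C -> 0 < eps -> eps <= e -> d <= C * e -> d' <= d - descent_rate e ->
  potential C eps d' <= potential C eps d - 1.
Proof.
move=> C0 e0 ee de dd; have r0 := descent_rate_ge0 e.
have d'd : d' <= d by lra.
have ez := lt_le_trans e0 ee.
apply: le_trans (potential_drop C0 e0 d'd ee de) _; rewrite lerD2l lerN2.
have D0 : 0 < 8 + 9 / 4 * e ^+ 2 by have := sqr_ge0 e; lra.
have r1 : descent_rate e * (8 / e ^+ 2 + 9 / 4) = 1.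
  by rewrite /descent_rate; field; rewrite gt_eqF //= gt_eqF //; lra.
rewrite -{1}r1; apply: ler_wpM2r; last lra.
by rewrite addr_ge0 // divr_ge0 // sqr_ge0.
Qed.

Lemma potential_homo (R : realType) (C eps d d' : R) :
  0 < C -> 0 < eps -> d' <= d -> potential C eps d' <= potential C eps d.
Proof.
move=> C0 e0 dd; pose z := Num.max eps (d / C).
have ez : eps <= z by rewrite le_max lexx.
have dz : d <= C * z by rewrite mulrC -ler_pdivrMr // le_max lexx orbT.
apply: le_trans (potential_drop C0 e0 dd ez dz) _.
by rewrite gerBl mulr_ge0 ?subr_ge0 // addr_ge0 // divr_ge0 // sqr_ge0.
Qed.

Lemma unit_decrease_bound (R : realType) (f : nat -> R) K :
  (forall k, (k < K)%N -> f k.+1 <= f k - 1) -> 0 <= f K -> K%:R <= f 0%N.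
Proof.
move=> fS fK; suff : forall k, (k <= K)%N -> f k <= f 0%N - k%:R.
  by move=> /(_ K (leqnn K)); lra.
elim=> [|k IH] kK; first by rewrite subr0.
have := fS k kK; have := IH (ltnW kK); rewrite -natr1; lra.
Qed.

Lemma approx_optimal_le (R : realType) n m (e e' : R) (X : 'M[R]_(n, m)) u :
  e <= e' -> approx_optimal e X u -> approx_optimal e' X u.
Proof.
move=> ee [[u0 pu ke] ke']; split; first split=> // i.
  by apply: le_trans (ke i) _; rewrite ler_wpM2r // lerD2l.
by move=> i /ke'; apply: le_trans; rewrite ler_wpM2r // lerD2l lerN2.
Qed.

(** Combines weak duality, where ln (1 + e) <= e, with e^T u - 1 <= e e^T u. The
latter follows from e^T (u kappa) = n and from the lower bound on kappa over the
support; it is needed because the iterates do not keep the sum 1. *)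
Lemma approx_optimal_gap (R : realType) n m (X : 'M[R]_(n, m))
    (u v : 'rV[R]_m) e :
  (0 < n)%N -> 0 <= e -> approx_optimal e X u ->
  (forall i, 0 <= v 0 i) -> posdef (XUXT X v) ->
  design_obj X u - design_obj X v <= n%:R * (1 + \sum_i u 0 i) * e.
Proof.
rewrite -(ltr0n R) => n0 e0 [[u0 pu ke] ke'] v0 pv.
have e1 : 0 < 1 + e by lra.
have lne : ln (1 + e) <= e by rewrite le_ln1Dx //; lra.
have sumu : (1 - e) * (\sum_i u 0 i) <= 1.
  rewrite -(ler_pM2r n0) mul1r -[leRHS](sum_kappa pu) mulrAC mulr_sumr.
  apply: ler_sum => i _; rewrite mulrC.
  have [->|ui] := eqVneq (u 0 i) 0; first by rewrite !mul0r.
  by apply: ler_wpM2l => //; apply: ke'; rewrite lt0r ui u0.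
apply: le_trans (design_obj_gap pu pv e1 v0 ke) _.
rewrite -mulrA ler_wpM2l ?(ltW n0) //; lra.
Qed.

Lemma cd_run_feasible (R : realType) n m (X : 'M[R]_(n, m))
    (u : nat -> 'rV[R]_m) :
  (forall i, col i X != 0) -> (forall i, 0 <= u 0%N 0 i) ->
  posdef (XUXT X (u 0%N)) -> cd_run X u ->
  forall k, (forall i, 0 <= u k 0 i) /\ posdef (XUXT X (u k)).
Proof.
move=> X0 u0 pu run; elim=> [|k [uk puk]]; first by split.
by have [] := cd_step_descent X0 uk puk (run k).
Qed.

Lemma design_obj_run_nincr (R : realType) n m (X : 'M[R]_(n, m))
    (u : nat -> 'rV[R]_m) :
  (forall i, col i X != 0) -> (forall i, 0 <= u 0%N 0 i) ->
  posdef (XUXT X (u 0%N)) -> cd_run X u ->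
  forall k l, (k <= l)%N -> design_obj X (u l) <= design_obj X (u k).
Proof.
move=> X0 u0 pu run k l /subnKC<-; elim: (l - k)%N => [|d IH].
  by rewrite addn0.
rewrite addnS; apply: le_trans IH.
have [uk puk] := cd_run_feasible X0 u0 pu run (k + d).
have [_ _ [e [e0 _]]] := cd_step_descent X0 uk puk (run (k + d)%N).
by case=> [[dd _]|[_ //]]; have := descent_rate_ge0 e; lra.
Qed.

(** An iterate that is not eps-approximately optimal has optimality error
e > eps, so [potential_step] applies to every step that is not a drop. The
factor 2 pays for a later drop of the index that such a step may add to the
support. *)
Lemma cd_step_count (R : realType) n m (X : 'M[R]_(n, m))
    (u : nat -> 'rV[R]_m) eps C K :
  (forall i, col i X != 0) -> (forall i, 0 <= u 0%N 0 i) ->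
  posdef (XUXT X (u 0%N)) -> cd_run X u ->
  (0 < n)%N -> 0 < eps ->
  (forall k, n%:R * (1 + \sum_i u k 0 i) <= C) ->
  (forall k, (k < K)%N -> ~ approx_optimal eps X (u k)) ->
  let p := potential C eps (design_obj X (u 0%N) - design_obj X (u K)) in
  K%:R <= 2 * p + (supp_size (u 0%N))%:R /\ (1 <= eps -> K%:R <= p).
Proof.
move=> X0 u0 pu run n0 eps0 uC napp /=.
have C0 : 0 < C.
  apply: lt_le_trans (uC 0%N); rewrite mulr_gt0 ?ltr0n //.
  by apply: ltr_pwDl => //; apply: sumr_ge0.
pose d k := design_obj X (u k) - design_obj X (u K).
have [uK puK] := cd_run_feasible X0 u0 pu run K.
have step k : (k < K)%N ->
    potential C eps (d k.+1) <= potential C eps (d k) - 1 /\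
      (supp_size (u k.+1) <= (supp_size (u k)).+1)%N \/
    [/\ eps < 1, potential C eps (d k.+1) <= potential C eps (d k) &
      (supp_size (u k.+1) < supp_size (u k))%N].
  move=> kK; have [uk puk] := cd_run_feasible X0 u0 pu run k.
  have [_ _ [e [e0 app]]] := cd_step_descent X0 uk puk (run k).
  have epse : eps < e.
    rewrite ltNge; apply/negP => ee.
    exact: (napp k kK (approx_optimal_le ee app)).
  have dC : d k <= C * e.
    apply: le_trans (approx_optimal_gap n0 e0 app uK puK) _.
    by rewrite ler_wpM2r.
  case=> [[dd ss]|[e1 dd ss]]; [left|right]; split=> //.
  - by apply: (potential_step C0 eps0 (ltW epse) dC); rewrite /d; lra.
  - exact: lt_trans e1.
  - by apply: potential_homo => //; rewrite /d; lra.
have dK : 0 <= potential C eps (d K) by rewrite potential_ge0 // /d subrr.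
split=> [|eps1].
- pose f k := 2 * potential C eps (d k) + (supp_size (u k))%:R.
  apply: (@unit_decrease_bound R f).
    move=> k /step; rewrite /f => -[[pd ss]|[_ pd ss]].
      have : (supp_size (u k.+1))%:R <= (supp_size (u k)).+1%:R :> R.
        by rewrite ler_nat.
      by rewrite -natr1; lra.
    have : (supp_size (u k.+1)).+1%:R <= (supp_size (u k))%:R :> R.
      by rewrite ler_nat.
    by rewrite -natr1; lra.
  by rewrite addr_ge0 // mulr_ge0.
- apply: (@unit_decrease_bound R (fun k => potential C eps (d k))) => //.
  by move=> k /step[[]//|[]]; rewrite ltNge eps1.
Qed.

(** The objective does not increase along the run and its sublevel sets are
bounded: choosing c twice as large as the bound on kappa(u_0) / n, the tangent
inequality leaves half of the linear term n e^T v to control the coordinates. *)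
Lemma iterate_coords_ubound (R : realType) n m (X : 'M[R]_(n, m))
    (u : nat -> 'rV[R]_m) :
  (forall i, col i X != 0) -> (forall i, 0 <= u 0%N 0 i) ->
  posdef (XUXT X (u 0%N)) -> cd_run X u -> (0 < n)%N ->
  has_ubound (iterate_coords u).
Proof.
move=> X0 u0 pu run n0; have nR : 0 < n%:R :> R by rewrite ltr0n.
pose c := 2 * (1 + \sum_i kappa X (u 0%N) i) / n%:R.
have kpos i : 0 < kappa X (u 0%N) i by exact: kappa_gt0.
have s0 : 0 <= \sum_i kappa X (u 0%N) i by apply: sumr_ge0 => i _; apply: ltW.
have c0 : 0 < c by rewrite divr_gt0 // mulr_gt0 // ltr_pwDl.
have kc i : kappa X (u 0%N) i <= c * n%:R / 2.
  have -> : c * n%:R / 2 = 1 + \sum_i kappa X (u 0%N) i.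
    by rewrite /c; field; rewrite gt_eqF.
  rewrite (bigD1 i) //=; have : 0 <= \sum_(j | j != i) kappa X (u 0%N) j.
    by apply: sumr_ge0 => j _; apply: ltW.
  lra.
(* B solves for the sum in the tangent inequality at u_0. *)
pose B := 2 / n%:R * (design_obj X (u 0%N) + ln (\det (XUXT X (u 0%N)))
   + n%:R * ln c).
exists B => z [k [i ->]].
have [uk puk] := cd_run_feasible X0 u0 pu run k.
have ui : u k 0 i <= \sum_j u k 0 j.
  by rewrite (bigD1 i) //= lerDl; apply: sumr_ge0.
apply: le_trans ui _.
have oi := design_obj_run_nincr X0 u0 pu run (leq0n k).
have := ln_det_XUXT_le pu puk c0.
have : (\sum_j u k 0 j * kappa X (u 0%N) j) / c <= n%:R / 2 * \sum_j u k 0 j.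
  rewrite ler_pdivrMr // mulr_sumr mulr_suml; apply: ler_sum => j _.
  have -> : n%:R / 2 * u k 0 j * c = u k 0 j * (c * n%:R / 2) by ring.
  exact: ler_wpM2l.
move=> h1 h2.
have h3 : n%:R * (\sum_j u k 0 j) <= n%:R * B.
  have -> : n%:R * B = 2 * (design_obj X (u 0%N)
     + ln (\det (XUXT X (u 0%N))) + n%:R * ln c).
    by rewrite /B; field; rewrite gt_eqF.
  by move: oi; rewrite {1}/design_obj; lra.
by move: h3; rewrite ler_pM2l.
Qed.

Lemma ln2_le (R : realType) : ln 2 <= 4 / 5 :> R.
Proof.
rewrite -ler_expR lnK ?posrE //.
rewrite expRM_natl.
have : 6 / 5 <= expR (5^-1 : R).
  apply: le_trans (expR_ge1Dx _).
  by rewrite le_eqVlt; apply/orP; left; apply/eqP; field.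
move=> h; have : (6 / 5) ^+ 4 <= expR (5^-1 : R) ^+ 4.
  by rewrite lerXn2r ?nnegrE ?expR_ge0 //; lra.
lra.
Qed.

Lemma ln2_ge (R : realType) : 2 / 3 <= ln 2 :> R.
Proof.
have : 1 <= 2 :> R by rewrite ler1n.
move=> /ln_ge_pade; apply: le_trans.
by rewrite le_eqVlt; apply/orP; left; apply/eqP; field.
Qed.

(** * Numerical constants and the complexity bound *)

(** Put y = L / ln 2, so that 1 / c1 >= y and n L / (c1 ln 2) >= y^2. The
bound ln t >= 1 - 1 / t at t = y / 2 gives ln y >= 1 + ln 2 - 2 / y, and the
constants 9/2 and 4 follow from ln 2 <= 4/5. *)
Lemma log_term_ge (R : realType) (n c1 L : R) :
  1 <= n -> 0 < c1 -> c1 * L <= ln 2 -> ln 2 <= L ->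
  0 <= n / c1 * ln (n * L / (c1 * ln 2)) /\
  n * (9 / 2 * L - 4) <= n / c1 * ln (n * L / (c1 * ln 2)).
Proof.
move=> n1 c0 cL Lge; have l2 := ln2_ge R; have l2' := ln2_le R.
have l0 : 0 < ln 2 :> R by lra.
have L0 : 0 < L by lra.
have n0 : 0 < n by lra.
pose y := L / ln 2.
have y1 : 1 <= y by rewrite /y ler_pdivlMr // mul1r.
have y0 : 0 < y by lra.
have yc : y <= c1^-1.
  by rewrite /y ler_pdivrMr // ler_pdivlMl.
have lny : 1 + ln 2 - 2 / y <= ln y.
  have : ln (1 + (2 / y - 1)) <= 2 / y - 1.
    by apply: le_ln1Dx; rewrite ltrBrDl subrr divr_gt0.
  by rewrite addrC subrK ln_div ?posrE //; lra.
have lnz : ln y *+ 2 <= ln (n * L / (c1 * ln 2)).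
  rewrite -lnXn // ler_ln ?posrE ?exprn_gt0 ?divr_gt0 ?mulr_gt0 //.
  have -> : n * L / (c1 * ln 2) = n * (c1^-1 * y).
    by rewrite /y; field; rewrite !gt_eqF.
  rewrite expr2; apply: (@le_trans _ _ (1 * (y * y))); first by rewrite mul1r.
  apply: ler_pM => //; first by rewrite mulr_ge0 // ltW.
  by rewrite ler_pM2r.
have lny0 : 0 <= ln y by rewrite ln_ge0.
have T0 : 0 <= ln (n * L / (c1 * ln 2)).
  by apply: le_trans lnz; rewrite mulrn_wge0.
split; first by rewrite mulr_ge0 // divr_ge0 // ltW.
apply: (@le_trans _ _ (n * y * ln (n * L / (c1 * ln 2)))); last first.
  by rewrite ler_wpM2r // ler_wpM2l // ltW.
rewrite -[leRHS]mulrA ler_pM2l //.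
apply: (@le_trans _ _ (y * (2 * (1 + ln 2 - 2 / y)))); last first.
  by rewrite ler_pM2l //; move: lnz; rewrite mulr2n; lra.
have -> : y * (2 * (1 + ln 2 - 2 / y)) = 2 * y + 2 * (y * ln 2) - 4.
  by field; rewrite gt_eqF.
have -> : y * ln 2 = L by rewrite /y divfK // gt_eqF.
have : 5 / 4 * L <= y by rewrite /y ler_pdivlMr //; nra.
lra.
Qed.

(** The common form of the two parts: c measures the quality of the initial
point, through kappa(u_0) <= c n, and s the size of its support. *)
Lemma cd_complexity (R : realType) n m (X : 'M[R]_(n, m))
    (u : nat -> 'rV[R]_m) eps c c1 s :
  (forall i, col i X != 0) -> (forall i, 0 <= u 0%N 0 i) ->
  posdef (XUXT X (u 0%N)) -> cd_run X u ->
  (0 < n)%N -> 0 < eps ->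
  \sum_i u 0%N 0 i = 1 -> (supp_size (u 0%N) <= s)%N ->
  2 <= c -> (forall i, kappa X (u 0%N) i <= c * n%:R) ->
  0 < c1 -> c1 * ln c <= ln 2 ->
  has_ubound (iterate_coords u) /\
  optimal_within eps X u
    (40 * n%:R * (1 + m%:R * u_max u) / eps
     + n%:R / c1 * ln (n%:R * ln c / (c1 * ln 2)) + s%:R).
Proof.
move=> X0 u0 pu run n0 eps0 u1 supp0 c2 kc c10 c1L.
have ub := iterate_coords_ubound X0 u0 pu run n0.
split=> //.
have n1 : 1 <= n%:R :> R by rewrite ler1n.
have nR : 0 < n%:R :> R by rewrite ltr0n.
have L2 : ln 2 <= ln c by rewrite ler_ln ?posrE //; lra.
have [T0 Tge] := log_term_ge n1 c10 c1L L2.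
set T := n%:R / c1 * _ in T0 Tge *.
have l2 := ln2_ge R.
set L := ln c in L2 Tge c1L *.
have uk_max k i : u k 0 i <= u_max u.
  by apply: ub_le_sup => //; exists k, i.
have sum_max k : \sum_i u k 0 i <= m%:R * u_max u.
  apply: (@le_trans _ _ (\sum_(i < m) u_max u)); first exact: ler_sum.
  by rewrite sumr_const card_ord mulr_natl.
pose C := n%:R * (1 + m%:R * u_max u).
have C2 : 2 * n%:R <= C.
  by rewrite mulrC /C ler_pM2l //; have := sum_max 0%N; rewrite u1; lra.
have C0 : 0 < C by lra.
have -> : 40 * n%:R * (1 + m%:R * u_max u) / eps = 40 * (C / eps).
  by rewrite /C; field; rewrite gt_eqF.
set B := _ + _ + _.
have Ceps : 2 * (n%:R / eps) <= C / eps by rewrite mulrA ler_pM2r ?invr_gt0.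
have neps : 0 < n%:R / eps by rewrite divr_gt0.
have sR : 0 <= s%:R :> R by [].
have B0 : 0 <= B by rewrite /B; lra.
apply: contrapT => notopt.
(* The least number of steps that exceeds B. *)
pose K := (Num.truncn B).+1.
have BK : B < K%:R by have /andP[] := truncn_itv B0.
have napp k : (k < K)%N -> ~ approx_optimal eps X (u k).
  move=> kK app; apply: notopt; exists k; split=> //.
  have /andP[+ _] := truncn_itv B0; apply: le_trans.
  by rewrite ler_nat -ltnS.
have uC k : n%:R * (1 + \sum_i u k 0 i) <= C.
  by rewrite ler_pM2l // lerD2l.
have [bnd1 bnd2] := cd_step_count X0 u0 pu run n0 eps0 uC napp.
set d := _ - _ in bnd1 bnd2.
have dL : d <= n%:R * L.
  have [uK puK] := cd_run_feasible X0 u0 pu run K.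
  have cpos : 0 < c by lra.
  have := design_obj_gap pu puK cpos uK kc.
  by rewrite u1 subrr addr0.
have pot := potential_le d C0 eps0.
have pot' : potential C eps d <= 16 * (C / eps) + 9 / 4 * d by lra.
have s0 : (supp_size (u 0%N))%:R <= s%:R :> R by rewrite ler_nat.
have Tge' : 9 / 2 * (n%:R * L) - 4 * n%:R <= T by lra.
have [eps1|eps1] := ltP eps 1.
  have nn : n%:R <= n%:R / eps by rewrite ler_pdivlMr // ger_pMr // ltW.
  by move: bnd1 BK; rewrite /B; lra.
have {}bnd2 := bnd2 eps1.
(* Up to eps = 12 the surplus 24 C / eps >= 48 n / eps covers the 4 n. *)
have [eps12|eps12] := leP eps 12.
  have nn : n%:R / 12 <= n%:R / eps.
    by rewrite ler_wpM2l ?lef_pV2 ?posrE // ltW.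
  have nL0 : 0 <= n%:R * L by rewrite mulr_ge0 //; lra.
  by move: bnd2 BK; rewrite /B; lra.
(* Otherwise kappa(u_0) <= c n <= (1 + eps) n, and as eps >= 1 the lower bound
   on kappa holds trivially: the initial iterate would do. *)
have c13 : 8 < c.
  rewrite ltNge; apply/negP => c8; apply: (napp 0%N) => //.
  split; first split=> // i.
    by apply: le_trans (kc i) _; rewrite ler_wpM2r //; lra.
  move=> i _; apply: (@le_trans _ _ 0); last exact/ltW/kappa_gt0.
  by rewrite mulr_le0_ge0 // subr_le0.
have L2' : 2 <= L.
  apply: (@le_trans _ _ (ln 2 *+ 3)); first by lra.
  rewrite -lnXn // /L ler_ln ?posrE //; lra.
have nL : 2 * n%:R <= n%:R * L by rewrite mulrC ler_pM2l.
by move: bnd2 BK; rewrite /B; lra.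
Qed.

Lemma weight_kappa_le (R : realType) n m (X : 'M[R]_(n, m))
    (u : 'rV[R]_m) j :
  (forall i, 0 <= u 0 i) -> posdef (XUXT X u) -> (forall i, col i X != 0) ->
  u 0 j * kappa X u j <= n%:R.
Proof.
move=> u0 pu X0; rewrite -(sum_kappa pu) (bigD1 j) //= lerDl.
by apply: sumr_ge0 => i _; rewrite mulr_ge0 // ltW // kappa_gt0.
Qed.

(** The constants c1 of both parts have the form ln a / ln b - 1 with a slightly
less than 2 b, and this number is at most ln 2 / ln b. *)
Lemma ln_ratio_bounds (R : realType) (a b L : R) :
  0 < L -> 1 <= b -> b < a -> a <= 2 * b -> L <= ln b ->
  0 < ln a / ln b - 1 /\ (ln a / ln b - 1) * L <= ln 2.
Proof.
move=> L0 b1 ba ab Lb; have b0 : 0 < b by lra.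
have lb : 0 < ln b by lra.
have lab : ln b < ln a by rewrite ltr_ln ?posrE //; lra.
have lab2 : ln a <= ln 2 + ln b.
  by rewrite -lnM ?posrE // ler_ln ?posrE ?mulr_gt0 //; lra.
have -> : ln a / ln b - 1 = (ln a - ln b) / ln b by field; rewrite gt_eqF.
split; first by rewrite divr_gt0 // subr_gt0.
rewrite mulrAC ler_pdivrMr //.
by apply: ler_pM => //; lra.
Qed.

Theorem theorem2 (R : realType) (n m : nat) (X : 'M[R]_(n, m)) (eps : R)
  (X_neq0 : forall i : 'I_m, col i X != 0)
  (X_span : points_span X predT)
  (eps_gt0 : 0 < eps) :
  ((2 <= m)%N ->
    forall u : nat -> 'rV[R]_m,
    u 0%N = KIS R m -> cd_run X u ->
    let c1 := ln (2 * m%:R - 1) / ln m%:R - 1 in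
    let c2 := c1 * ln 2 in
    has_ubound (iterate_coords u) /\
    optimal_within eps X u
      (40 * n%:R * (1 + m%:R * u_max u) / eps
       + n%:R / c1 * ln (n%:R * ln m%:R / c2) + m%:R))
  /\
  ((2 <= n)%N ->
    forall u : nat -> 'rV[R]_m,
    KYIS X (u 0%N) -> cd_run X u ->
    let c1 := ln (1 + 2 * n%:R ^+ 5) / ln (1 + n%:R ^+ 5) - 1 in
    let c2 := c1 * ln 2 in
    has_ubound (iterate_coords u) /\
    optimal_within eps X u
      (40 * n%:R * (1 + m%:R * u_max u) / eps
       + n%:R / c1 * ln (5 * n%:R * ln n%:R / c2) + 2 * n%:R)).
Proof.
split.
- move=> m2 u u0E run c1 c2.
  have m0 : 0 < m%:R :> R by rewrite ltr0n (leq_trans _ m2).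
  have mR : 2 <= m%:R :> R by rewrite ler_nat.
  have u0 i : 0 < u 0%N 0 i by rewrite u0E mxE invr_gt0.
  have u0' i : 0 <= u 0%N 0 i by apply: ltW.
  have pu := posdef_of_span X_span u0.
  have n0 : (0 < n)%N.
    rewrite lt0n; apply/eqP => n0.
    have /eqP[] := X_neq0 (Ordinal (ltnW m2)).
    by apply/matrixP => -[i lin]; exfalso; move: lin; rewrite n0.
  have Lm : 0 < ln m%:R :> R by rewrite ln_gt0 //; lra.
  have [c1_gt0 c1L] : 0 < c1 /\ c1 * ln m%:R <= ln 2.
    by apply: ln_ratio_bounds => //; lra.
  apply: cd_complexity c1_gt0 c1L => //.
  + rewrite u0E; under eq_bigr do rewrite mxE.
    by rewrite sumr_const card_ord -[LHS]mulr_natl mulfV // gt_eqF.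
  + by apply: leq_trans (max_card _) _; rewrite card_ord.
  + move=> i; have := weight_kappa_le i u0' pu X_neq0.
    by rewrite {1}u0E mxE ler_pdivrMl.
- move=> n2 u [u0 u1 card0 _ [_ pu kc]] run c1 c2.
  have nR : 2 <= n%:R :> R by rewrite ler_nat.
  have n5 : 2 <= n%:R ^+ 5 :> R.
    by apply: le_trans (ler_eXnr _ _) => //; lra.
  have ln5 : ln (n%:R ^+ 5) = 5 * ln n%:R :> R.
    by rewrite lnXn ?mulr_natl //; lra.
  have [c1_gt0 c1L] : 0 < c1 /\ c1 * ln (n%:R ^+ 5) <= ln 2.
    apply: ln_ratio_bounds; try lra; first by rewrite ln_gt0 //; lra.
    by rewrite ler_ln ?posrE; lra.
  have -> : 5 * n%:R * ln n%:R = n%:R * ln (n%:R ^+ 5) :> R.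
    by rewrite ln5; ring.
  rewrite -[2 * n%:R]natrM.
  apply: cd_complexity c1_gt0 c1L => //; first exact: ltnW.
  by move=> i; apply: le_trans (kc i) _; rewrite addrC subrK.
Qed.
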